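(* Let $Q$ be a strong commutative semicartesian quantale. The categories $\mathbf{ScottQSet}_f$ and $\mathbf{ScottQSet}_r$ of Scott-complete $Q$-sets with, respectively, functional and relational morphisms are isomorphic: $$\mathbf{ScottQSet}_f\cong\mathbf{ScottQSet}_r.$$ More precisely, for a relational morphism $\phi:X\to Y$ between Scott-complete $Q$-sets let $\mathcal{F}(\phi):X\to Y$ be the map sending $x$ to the unique $y\in Y$ representing the singleton $\phi(x,-)$ on $Y$. Then $\mathcal{F}(\phi)$ is a functional morphism, and $\mathcal{F}$ (acting as the identity on objects) is a functor $\mathbf{ScottQSet}_r\to\mathbf{ScottQSet}_f$ which is inverse to the restriction $\mathbf{ScottQSet}_f\to\mathbf{ScottQSet}_r$ of the graph functor $\Gamma$.
   Context: A quantale is a complete lattice $(Q,\le)$ with an associative binary operation $\otimes$ that distributes over arbitrary suprema in each variable. It is commutative if $\otimes$ is commutative; semicartesian if $a\otimes b\le a\wedge b$ for all $a,b$; strong if for every $e\in Q$ with $e=e\otimes e$ and every $A\subseteq Q$, $e\le\bigvee_{a\in A}a$ implies $e\le\bigvee_{a\in A}a\otimes a$. A $Q$-set is a set $X$ with a map $\delta:X\times X\to Q$ such that for all $x,y,z$: $\delta(x,y)=\delta(y,x)$; $\delta(x,y)\otimes\delta(y,z)\le\delta(x,z)$; $\delta(x,x)\otimes\delta(x,y)=\delta(x,y)$. The extent of $x$ is $Ex:=\delta(x,x)$. $\mathbf{QSet}_f$ is the category of $Q$-sets with functional morphisms: functions $f:X\to Y$ with $\delta(x,x')\le\delta(f(x),f(x'))$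 and $Ef(x)=Ex$, composed as functions. A relational morphism $\phi:X\to Y$ is a function $\phi:X\times Y\to Q$ such that for all $x,x'\in X$, $y,y'\in Y$: $\delta(x,x')\otimes\phi(x,y)\le\phi(x',y)$; $\phi(x,y)\otimes\delta(y,y')\le\phi(x,y')$; $\phi(x,y)\otimes\phi(x,y')\le\delta(y,y')$; $\phi(x,y)\otimes Ey=\phi(x,y)$; $Ex\otimes\phi(x,y)=\phi(x,y)$; $\bigvee_{y\in Y}\phi(x,y)=Ex$. Composition is $[\psi\circ\phi](x,z)=\bigvee_{y\in Y}\phi(x,y)\otimes\psi(y,z)$ and the identity of $X$ is $\delta_X$; this is the category $\mathbf{QSet}_r$. The graph functor $\Gamma:\mathbf{QSet}_f\to\mathbf{QSet}_r$ is the identity on objects and $(\Gamma f)(x,y)=\delta(f(x),y)$. A singleton on $X$ is a map $\sigma:X\to Q$ such that for all $x,y\in X$: $\sigma(x)\otimes Ex=\sigma(x)$; $\sigma(x)\otimes\delta(x,y)\le\sigma(y)$; $\sigma(x)\otimes\sigma(y)\le\delta(x,y)$; $\sigma(x)\otimes\bigvee_{y\in X}\sigma(y)=\sigma(x)$. For a relational morphism $\phi:X\to Y$ and $x\in X$, the map $\phi(x,-)$ is a singleton on $Y$. An element $x_\sigma\in X$ represents $\sigma$ if $\sigma(y)=\delta(y,x_\sigma)$ for all $y\in X$. $X$ is Scott-complete if every singleton on $X$ has exactly one representing element. $\mathbf{ScottQSet}_f$ and $\mathbf{ScottQSet}_r$ are the full subcategories of $\mathbf{QSet}_f$ and $\mathbf{QSet}_r$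 on Scott-complete $Q$-sets. *)

(* Defs.v *)
From HB Require Import structures.
From mathcomp Require Import all_boot all_order.
From mathcomp Require Import boolp classical_sets.

Set Implicit Arguments.
Unset Strict Implicit.
Unset Printing Implicit Defensive.

Import Order.TTheory.
Local Open Scope order_scope.
Local Open Scope classical_set_scope.

Record category := Category {
  obj :> Type;
  hom : obj -> obj -> Type;
  idm : forall x, hom x x;
  comp : forall x y z, hom y z -> hom x y -> hom x z;
  comp_idl : forall x y (f : hom x y), comp (idm y) f = f;
  comp_idr : forall x y (f : hom x y), comp f (idm x) = f;
  compA : forall x y z t (h : hom z t) (g : hom y z) (f : hom x y),
    comp h (comp g f) = comp (comp h g) f }.

Arguments hom {c} x y.
Arguments idm {c} x.
Arguments comp {c x y z} g f.

Definition preserves_idm (C D : category) (F : C -> D)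
    (Fm : forall x y, hom x y -> hom (F x) (F y)) : Prop :=
  forall x, Fm x x (idm x) = idm (F x).

Definition preserves_comp (C D : category) (F : C -> D)
    (Fm : forall x y, hom x y -> hom (F x) (F y)) : Prop :=
  forall x y z (g : hom y z) (f : hom x y),
    Fm x z (comp g f) = comp (Fm y z g) (Fm x y f).

Record functor (C D : category) := Functor {
  fobj :> C -> D;
  fmap : forall x y, hom x y -> hom (fobj x) (fobj y);
  fmap_idm : preserves_idm fmap;
  fmap_comp : preserves_comp fmap }.

Arguments fmap {C D} F {x y} f : rename.

Definition id_functor (C : category) : functor C C :=
  @Functor C C (fun x => x) (fun x y f => f) (fun=> erefl)
    (fun _ _ _ _ _ => erefl).

Section CompFunctor.
Variables (C D E : category) (G : functor D E) (F : functor C D).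

Let m x y (f : hom x y) : hom (G (F x)) (G (F y)) := fmap G (fmap F f).

Let m_idm : preserves_idm m.
Proof. by move=> x; rewrite /m !fmap_idm. Qed.

Let m_comp : preserves_comp m.
Proof. by move=> x y z g f; rewrite /m !fmap_comp. Qed.

Definition comp_functor : functor C E := Functor m_idm m_comp.

End CompFunctor.

(* Strict equality of functors: isomorphism, not equivalence, of categories. *)
Definition inverse_functors (C D : category)
    (F : functor C D) (G : functor D C) : Prop :=
  comp_functor G F = id_functor C /\ comp_functor F G = id_functor D.

Definition cat_isomorphic (C D : category) : Prop :=
  exists (F : functor C D) (G : functor D C), inverse_functors F G.

Definition full_subcategory (C : category) (P : C -> Prop) : category :=
  @Category {x : C | P x} (fun x y => hom (sval x) (sval y))
    (fun x => idm (sval x)) (fun _ _ _ g f => comp g f)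
    (fun _ _ f => comp_idl f) (fun _ _ f => comp_idr f)
    (fun _ _ _ _ h g f => compA h g f).

(* [supremums A] is the set of least upper bounds of [A], so [qsupP] makes the
   underlying lattice complete; [A] may be empty. *)
HB.mixin Record Lattice_isQuantale d Q of Order.Lattice d Q := {
  qsup : set Q -> Q;
  qsupP : forall A : set Q, supremums A (qsup A);
  qmul : Q -> Q -> Q;
  qmulA : associative qmul;
  qmul_supr : forall (a : Q) (B : set Q),
    qmul a (qsup B) = qsup [set qmul a b | b in B];
  qmul_supl : forall (A : set Q) (b : Q),
    qmul (qsup A) b = qsup [set qmul a b | a in A] }.

#[short(type="quantaleType")]
HB.structure Definition Quantale d :=
  { Q of Lattice_isQuantale d Q & Order.Lattice d Q }.

Declare Scope quantale_scope.
Delimit Scope quantale_scope with QT.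
Local Open Scope quantale_scope.
Notation "a ⊗ b" := (qmul a b) (at level 40, left associativity)
  : quantale_scope.

HB.mixin Record Quantale_isCommSemicartesian d Q of Quantale d Q := {
  qmulC : commutative (@qmul d Q);
  qmul_le_meet : forall a b : Q, a ⊗ b <= (a `&` b)%O }.

#[short(type="csQuantaleType")]
HB.structure Definition CSQuantale d :=
  { Q of Quantale_isCommSemicartesian d Q & Quantale d Q }.

Definition strong d (Q : quantaleType d) : Prop :=
  forall (e : Q) (A : set Q), e = e ⊗ e ->
    e <= qsup A -> e <= qsup [set a ⊗ a | a in A].

Section QuantaleTheory.
Context d (Q : quantaleType d).
Implicit Types (a b c : Q) (A : set Q).

Lemma qsup_ub A a : A a -> a <= qsup A.
Proof. by case: (qsupP A) => + _; apply. Qed.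

Lemma qsup_le A b : (forall a, A a -> a <= b) -> qsup A <= b.
Proof. by case: (qsupP A) => _; apply. Qed.

Lemma qsup_ubf (I : Type) (f : I -> Q) i : f i <= qsup (range f).
Proof. by apply: qsup_ub; exists i. Qed.

Lemma qsup_lef (I : Type) (f : I -> Q) b :
  (forall i, f i <= b) -> qsup (range f) <= b.
Proof. by move=> h; apply: qsup_le => _ [i _ <-]. Qed.

Lemma qsup2 a b : a <= b -> qsup [set a; b] = b.
Proof.
move=> ab; apply/le_anti/andP; split; last by apply: qsup_ub; right.
by apply: qsup_le => x [->|->].
Qed.

Lemma qmul_le2l a b c : b <= c -> a ⊗ b <= a ⊗ c.
Proof.
move=> bc; rewrite -(qsup2 bc) qmul_supr; apply: qsup_ub.
by exists b => //; left.
Qed.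

Lemma qmul_le2r a b c : b <= c -> b ⊗ a <= c ⊗ a.
Proof.
move=> bc; rewrite -(qsup2 bc) qmul_supl; apply: qsup_ub.
by exists b => //; left.
Qed.

Lemma qmul_le2 a b a' b' : a <= a' -> b <= b' -> a ⊗ b <= a' ⊗ b'.
Proof. by move=> h k; apply: le_trans (qmul_le2l _ k) (qmul_le2r _ h). Qed.

Lemma qmul_suprf (I : Type) a (f : I -> Q) :
  a ⊗ qsup (range f) = qsup (range (fun i => a ⊗ f i)).
Proof. by rewrite qmul_supr image_comp. Qed.

Lemma qmul_suplf (I : Type) a (f : I -> Q) :
  qsup (range f) ⊗ a = qsup (range (fun i => f i ⊗ a)).
Proof. by rewrite qmul_supl image_comp. Qed.

End QuantaleTheory.

Section CSQuantaleTheory.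
Context d (Q : csQuantaleType d).
Implicit Types (a b : Q).

Lemma qmul_lel a b : a ⊗ b <= a.
Proof. exact: le_trans (qmul_le_meet a b) (leIl _ _). Qed.

Lemma qmul_ler a b : a ⊗ b <= b.
Proof. exact: le_trans (qmul_le_meet a b) (leIr _ _). Qed.

End CSQuantaleTheory.

Record qset d (Q : quantaleType d) := QSet {
  qcarrier :> Type;
  delta : qcarrier -> qcarrier -> Q;
  delta_sym : forall x y, delta x y = delta y x;
  delta_trans : forall x y z, delta x y ⊗ delta y z <= delta x z;
  delta_ext : forall x y, delta x x ⊗ delta x y = delta x y }.

Definition extent d (Q : quantaleType d) (X : qset Q) (x : X) : Q := delta x x.

Definition is_functional d (Q : quantaleType d) (X Y : qset Q)
    (f : X -> Y) : Prop :=
  (forall x x', delta x x' <= delta (f x) (f x')) /\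
  (forall x, extent (f x) = extent x).

Record funMor d (Q : quantaleType d) (X Y : qset Q) := FunMor {
  funMor_fun :> X -> Y;
  funMorP : is_functional funMor_fun }.

Lemma funMor_ext d (Q : quantaleType d) (X Y : qset Q) (f g : funMor X Y) :
  f =1 g -> f = g.
Proof.
case: f g => [f fP] [g gP] /= /funext fg; subst g.
by congr FunMor; exact: Prop_irrelevance.
Qed.

Section QSetF.
Context d (Q : quantaleType d).

Let idP (X : qset Q) : is_functional (fun x : X => x).
Proof. by []. Qed.

Let compP (X Y Z : qset Q) (g : funMor Y Z) (f : funMor X Y) :
  is_functional (fun x => g (f x)).
Proof.
case: g f => [g [g1 g2]] [f [f1 f2]] /=; split=> [x x'|x].
  exact: le_trans (f1 _ _) (g1 _ _).
by rewrite g2 f2.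
Qed.

Let idl (X Y : qset Q) (f : funMor X Y) :
  FunMor (compP (FunMor (@idP Y)) f) = f.
Proof. exact: funMor_ext. Qed.

Let idr (X Y : qset Q) (f : funMor X Y) :
  FunMor (compP f (FunMor (@idP X))) = f.
Proof. exact: funMor_ext. Qed.

Let assoc (X Y Z T : qset Q)
    (h : funMor Z T) (g : funMor Y Z) (f : funMor X Y) :
  FunMor (compP h (FunMor (compP g f))) = FunMor (compP (FunMor (compP h g)) f).
Proof. exact: funMor_ext. Qed.

Definition QSet_f : category :=
  @Category (qset Q) (@funMor d Q) (fun X => FunMor (@idP X))
    (fun X Y Z g f => FunMor (compP g f)) idl idr assoc.

End QSetF.

Definition is_relational d (Q : quantaleType d) (X Y : qset Q)
    (phi : X -> Y -> Q) : Prop :=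
  [/\ (forall x x' y, delta x x' ⊗ phi x y <= phi x' y) /\
      (forall x y y', phi x y ⊗ delta y y' <= phi x y'),
      forall x y y', phi x y ⊗ phi x y' <= delta y y',
      forall x y, phi x y ⊗ extent y = phi x y,
      forall x y, extent x ⊗ phi x y = phi x y &
      forall x, qsup (range (phi x)) = extent x].

Record relMor d (Q : quantaleType d) (X Y : qset Q) := RelMor {
  relMor_fun :> X -> Y -> Q;
  relMorP : is_relational relMor_fun }.

Lemma relMor_ext d (Q : quantaleType d) (X Y : qset Q) (f g : relMor X Y) :
  (forall x y, f x y = g x y) -> f = g.
Proof.
case: f g => [f fP] [g gP] /= fg.
have {}fg : f = g by apply: funext => x; apply: funext.
by subst g; congr RelMor; exact: Prop_irrelevance.
Qed.

Section QSetR.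
Context d (Q : csQuantaleType d).

Let idP (X : qset Q) : is_relational (@delta d Q X).
Proof.
have ext (x y : X) : delta x y ⊗ extent y = delta x y.
  by rewrite qmulC delta_sym delta_ext.
split=> //; first split=> x.
- by move=> x' y; rewrite (delta_sym x); apply: delta_trans.
- exact: delta_trans.
- by move=> x y y'; rewrite (delta_sym x y); apply: delta_trans.
- exact: delta_ext.
- move=> x; apply/le_anti/andP; split; last exact: (qsup_ubf (delta x) x).
  by apply: qsup_lef => y; rewrite -delta_ext; apply: qmul_lel.
Qed.

Definition relComp (X Y Z : qset Q) (psi : Y -> Z -> Q) (phi : X -> Y -> Q)
    (x : X) (z : Z) : Q :=
  qsup (range (fun y => phi x y ⊗ psi y z)).

Let compP (X Y Z : qset Q) (psi : relMor Y Z) (phi : relMor X Y) :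
  is_relational (relComp psi phi).
Proof.
case: psi phi => [p [[p1 p2] p3 p4 p5 p6]] [f [[f1 f2] f3 f4 f5 f6]] /=.
rewrite /relComp; split.
- split=> [x x' z|x z z'].
    rewrite qmul_suprf; apply: qsup_lef => y; rewrite qmulA.
    apply: le_trans (qsup_ubf _ y); exact: qmul_le2r.
  rewrite qmul_suplf; apply: qsup_lef => y; rewrite -qmulA.
  apply: le_trans (qsup_ubf _ y); exact: qmul_le2l.
- move=> x z z'; rewrite qmul_suplf; apply: qsup_lef => y.
  rewrite qmul_suprf; apply: qsup_lef => y'.
  rewrite qmulA -[X in X ⊗ _]qmulA (qmulC (p y z)) qmulA.
  apply: le_trans (p3 y' z z'); apply: qmul_le2r.
  apply: le_trans (p1 y y' z); exact: qmul_le2r.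
- move=> x z; rewrite qmul_suplf; congr (qsup _).
  by apply: eq_imagel => y _; rewrite -qmulA p4.
- move=> x z; rewrite qmul_suprf; congr (qsup _).
  by apply: eq_imagel => y _; rewrite qmulA f5.
- move=> x; rewrite -f6; apply/le_anti/andP; split.
    apply: qsup_lef => z; apply: qsup_lef => y.
    by apply: le_trans (qsup_ubf (f x) y); apply: qmul_lel.
  apply: qsup_lef => y; rewrite -f4 -p6 qmul_suprf; apply: qsup_lef => z.
  apply: le_trans (qsup_ubf _ z); exact: (qsup_ubf _ y).
Qed.

Let idl (X Y : qset Q) (phi : relMor X Y) :
  RelMor (compP (RelMor (@idP Y)) phi) = phi.
Proof.
apply: relMor_ext => x y /=; case: phi => [f [[f1 f2] f3 f4 f5 f6]] /=.
apply/le_anti/andP; split; first by apply: qsup_lef => y'; apply: f2.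
by rewrite -{1}f4; apply: (qsup_ubf _ y).
Qed.

Let idr (X Y : qset Q) (phi : relMor X Y) :
  RelMor (compP phi (RelMor (@idP X))) = phi.
Proof.
apply: relMor_ext => x y /=; case: phi => [f [[f1 f2] f3 f4 f5 f6]] /=.
apply/le_anti/andP; split; last by rewrite -{1}f5; apply: (qsup_ubf _ x).
by apply: qsup_lef => x'; rewrite delta_sym; apply: f1.
Qed.

Let assoc (X Y Z T : qset Q)
    (h : relMor Z T) (g : relMor Y Z) (f : relMor X Y) :
  RelMor (compP h (RelMor (compP g f))) = RelMor (compP (RelMor (compP h g)) f).
Proof.
apply: relMor_ext => x t /=; rewrite /relComp; apply/le_anti/andP; split.
  apply: qsup_lef => z; rewrite qmul_suplf; apply: qsup_lef => y.
  rewrite -qmulA; apply: le_trans (qsup_ubf _ y); apply: qmul_le2l.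
  exact: (qsup_ubf _ z).
apply: qsup_lef => y; rewrite qmul_suprf; apply: qsup_lef => z.
rewrite qmulA; apply: le_trans (qsup_ubf _ z); apply: qmul_le2r.
exact: (qsup_ubf _ y).
Qed.

Definition QSet_r : category :=
  @Category (qset Q) (@relMor d Q) (fun X => RelMor (@idP X))
    (fun X Y Z psi phi => RelMor (compP psi phi)) idl idr assoc.

End QSetR.

Section Graph.
Context d (Q : csQuantaleType d).

Let graphP (X Y : qset Q) (f : funMor X Y) :
  is_relational (fun x y => delta (f x) y).
Proof.
case: f => [f [f1 f2]] /=; have [[i1 i2] i3 i4 i5 i6] := relMorP (idm (Y : QSet_r Q)).
split=> //; first split=> [x x' y|x y y'].
- by apply: le_trans (i1 (f x) _ _); apply: qmul_le2r.
- exact: i2.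
- by move=> x; apply: i3.
- by move=> x; apply: i4.
- by move=> x y; rewrite -f2; apply: i5.
- by move=> x; rewrite -f2; apply: i6.
Qed.

Let m (X Y : QSet_f Q) (f : hom X Y) : @hom (QSet_r Q) X Y :=
  RelMor (graphP f).

Let m_idm : @preserves_idm (QSet_f Q) (QSet_r Q) (fun X => X) m.
Proof. by move=> X; apply: relMor_ext. Qed.

Let m_comp : @preserves_comp (QSet_f Q) (QSet_r Q) (fun X => X) m.
Proof.
move=> X Y Z g f; apply: relMor_ext => x z /=; apply/le_anti/andP; split.
  apply: le_trans (qsup_ubf _ (f x)).
  by case: g => [g [_ g2]] /=; rewrite -[_ (f x) (f x)]g2 delta_ext.
apply: qsup_lef => y; case: g => [g [g1 _]] /=.
exact: le_trans (qmul_le2r _ (g1 _ _)) (delta_trans _ _ _).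
Qed.

Definition graph_functor : functor (QSet_f Q) (QSet_r Q) :=
  Functor m_idm m_comp.

End Graph.

Definition is_singleton d (Q : quantaleType d) (X : qset Q)
    (sigma : X -> Q) : Prop :=
  [/\ forall x, sigma x ⊗ extent x = sigma x,
      forall x y, sigma x ⊗ delta x y <= sigma y,
      forall x y, sigma x ⊗ sigma y <= delta x y &
      forall x, sigma x ⊗ qsup (range sigma) = sigma x].

Definition represents d (Q : quantaleType d) (X : qset Q)
    (x : X) (sigma : X -> Q) : Prop :=
  forall y, sigma y = delta y x.

Definition Scott_complete d (Q : quantaleType d) (X : qset Q) : Prop :=
  forall sigma : X -> Q, is_singleton sigma -> exists! x, represents x sigma.

Definition ScottQSet_f d (Q : csQuantaleType d) : category :=
  @full_subcategory (QSet_f Q) (@Scott_complete d Q).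

Definition ScottQSet_r d (Q : csQuantaleType d) : category :=
  @full_subcategory (QSet_r Q) (@Scott_complete d Q).

(* Same action on morphisms as [graph_functor]; the object part is literally
   [fun X => X], so no transport is needed when composing with functors that
   are the identity on objects. *)
Definition Scott_graph d (Q : csQuantaleType d) :
    functor (ScottQSet_f Q) (ScottQSet_r Q) :=
  @Functor (ScottQSet_f Q) (ScottQSet_r Q) (fun X => X)
    (fun X Y f => fmap (graph_functor Q) f)
    (fun X => fmap_idm (graph_functor Q) (sval X))
    (fun X Y Z g f => fmap_comp (graph_functor Q) g f).

Lemma relMor_singleton d (Q : csQuantaleType d) (X Y : qset Q)
  (phi : relMor X Y) (x : X) : is_singleton (phi x).
Proof.
case: phi => [f [[f1 f2] f3 f4 f5 f6]]; split=> //= y.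
by rewrite f6 qmulC f5.
Qed.

(* The unique representing element of the singleton [phi x -]. *)
Definition Scott_repr d (Q : csQuantaleType d) (X Y : qset Q)
    (Yc : Scott_complete Y) (phi : relMor X Y) (x : X) : Y :=
  sval (cid (Yc (phi x) (relMor_singleton phi x))).

(* Main.v *)
Require Import Defs.
From HB Require Import structures.
From mathcomp Require Import all_boot all_order.
From mathcomp Require Import boolp classical_sets.

(** For a relational morphism [phi : X -> Y] into a Scott-complete [Y], the
    point [f x] representing the singleton [phi x -] satisfies
    [phi x y = delta y (f x)] by its very definition ([Scott_reprE]), so [phi]
    is the graph of [f].  That [f] is functional ([Scott_repr_functional]) is
    read off from this formula: the extent of [f x] is the supremum of the
    column [delta - (f x) = phi x -], which is the extent of [x], and
    [delta x x' <= delta (f x) (f x')] is the compatibility of [phi] with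
    [delta] on [X], evaluated at [y = f x].  Conversely [f x] represents
    the singleton [delta (f x) -], and by uniqueness it is the chosen point
    ([Scott_repr_graph]).

    Thus on hom-sets the graph functor and [Scott_repr] are mutually inverse.
    As the graph functor is then injective on morphisms, functoriality of
    [Scott_repr] need not be computed with suprema: both sides of
    each functor law have the same graph.  The two composite functors are the
    identity on objects and on morphisms, hence strictly equal to the identity
    functors ([identity_on_homs]). *)

Set Implicit Arguments.
Unset Strict Implicit.
Unset Printing Implicit Defensive.

Import Order.TTheory.
Local Open Scope order_scope.
Local Open Scope classical_set_scope.
Local Open Scope quantale_scope.

(** Stated for a literally identical object map, so that equality of functors
    reduces to equality of morphisms without transport along equalities of
    objects. *)
Lemma identity_on_homs (C : category)
    (m : forall x y : C, hom x y -> hom x y)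
    (m_idm : @preserves_idm C C (fun x => x) m)
    (m_comp : @preserves_comp C C (fun x => x) m) :
  (forall x y (f : hom x y), m x y f = f) ->
  Functor m_idm m_comp = id_functor C.
Proof.
move=> m_id; have mE : m = fun x y f => f.
  by apply: functional_extensionality_dep => x;
     apply: functional_extensionality_dep => y; apply: funext.
by subst m; congr Functor; exact: Prop_irrelevance.
Qed.

Section ScottRepr.
Context d (Q : csQuantaleType d).

Lemma delta_le_extent (X : qset Q) (x y : X) : delta y x <= extent x.
Proof. by rewrite delta_sym -delta_ext; apply: qmul_lel. Qed.

Section Repr.
Variables (X Y : qset Q) (Yc : Scott_complete Y).

Lemma Scott_reprE (phi : relMor X Y) x y :
  phi x y = delta y (Scott_repr Yc phi x).
Proof. by rewrite /Scott_repr; case: cid => z /= [+ _]; apply. Qed.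

Lemma Scott_repr_unique (phi : relMor X Y) x y :
  represents y (phi x) -> Scott_repr Yc phi x = y.
Proof. by rewrite /Scott_repr; case: cid => z /= [_]; apply. Qed.

(** The supremum of [delta - y] is attained at [y], where it is the extent of
    [y]; for [y] representing [phi x -] it is also the extent of [x]. *)
Lemma extent_Scott_repr (phi : relMor X Y) x :
  extent (Scott_repr Yc phi x) = extent x.
Proof.
have [_ _ _ _ <-] := relMorP phi.
apply/le_anti/andP; split; first by rewrite /extent -Scott_reprE qsup_ubf.
by apply: qsup_lef => y; rewrite Scott_reprE delta_le_extent.
Qed.

Lemma Scott_repr_functional (phi : relMor X Y) :
  is_functional (Scott_repr Yc phi).
Proof.
split=> [x x'|x]; last exact: extent_Scott_repr.
have [[phi_delta _] _ _ _ _] := relMorP phi.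
(* [phi x (f x)] is the extent of [x], which absorbs into [delta x x']. *)
rewrite -delta_ext -[delta x x]/(extent x) -(extent_Scott_repr phi).
by rewrite /extent -!Scott_reprE qmulC phi_delta.
Qed.

Lemma graph_Scott_repr (phi : relMor X Y) :
  fmap (graph_functor Q) (FunMor (Scott_repr_functional phi) :
    @hom (QSet_f Q) X Y) = phi.
Proof. by apply: relMor_ext => x y /=; rewrite delta_sym -Scott_reprE. Qed.

Lemma Scott_repr_graph (f : @hom (QSet_f Q) X Y) :
  FunMor (Scott_repr_functional (fmap (graph_functor Q) f)) = f.
Proof.
by apply: funMor_ext => x; apply: Scott_repr_unique => y; apply: delta_sym.
Qed.

Lemma graph_inj (f g : @hom (QSet_f Q) X Y) :
  fmap (graph_functor Q) f = fmap (graph_functor Q) g -> f = g.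
Proof. by move=> fg; rewrite -(Scott_repr_graph f) fg Scott_repr_graph. Qed.

End Repr.

Let F (X Y : ScottQSet_r Q) (phi : hom X Y) : @hom (ScottQSet_f Q) X Y :=
  FunMor (Scott_repr_functional (svalP Y) phi).

Lemma Scott_repr_idm :
  @preserves_idm (ScottQSet_r Q) (ScottQSet_f Q) (fun X => X) F.
Proof.
move=> X; apply: (graph_inj (svalP X)).
by rewrite graph_Scott_repr (fmap_idm (graph_functor Q)).
Qed.

Lemma Scott_repr_comp :
  @preserves_comp (ScottQSet_r Q) (ScottQSet_f Q) (fun X => X) F.
Proof.
move=> X Y Z psi phi; apply: (graph_inj (svalP Z)).
by rewrite graph_Scott_repr (fmap_comp (graph_functor Q)) !graph_Scott_repr.
Qed.

Lemma Scott_graph_inverse :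
  inverse_functors (Scott_graph Q) (Functor Scott_repr_idm Scott_repr_comp).
Proof.
split; apply: identity_on_homs => X Y f.
- exact: Scott_repr_graph.
- exact: graph_Scott_repr.
Qed.

End ScottRepr.

Theorem mainTheorem7 (d : Order.disp_t) (Q : csQuantaleType d)
    (Q_strong : strong Q) :
  cat_isomorphic (ScottQSet_f Q) (ScottQSet_r Q) /\
  exists F_functional : forall (X Y : ScottQSet_r Q) (phi : hom X Y),
      is_functional (Scott_repr (svalP Y) phi),
    let F (X Y : ScottQSet_r Q) (phi : hom X Y) : @hom (ScottQSet_f Q) X Y :=
      FunMor (F_functional X Y phi) in
    exists (F_idm : @preserves_idm (ScottQSet_r Q) (ScottQSet_f Q)
                      (fun X => X) F)
           (F_comp : @preserves_comp (ScottQSet_r Q) (ScottQSet_f Q)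
                      (fun X => X) F),
      inverse_functors (Scott_graph Q) (Functor F_idm F_comp).
Proof.
split; first by eexists; eexists; exact: Scott_graph_inverse.
exists (fun X Y phi => Scott_repr_functional (svalP Y) phi).
exists (@Scott_repr_idm d Q), (@Scott_repr_comp d Q).
exact: Scott_graph_inverse.
Qed.
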